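(* Let $0 < \rho \leq \widetilde{\rho} \leq +\infty$ with $\rho < \infty$, let $0 < \epsilon \leq \widetilde{\rho} - \rho/2$, and let $p \geq 2$ be an integer. Suppose $\Lambda : (-\widetilde{\rho}, \widetilde{\rho}) \to \mathbb{R}$ is integrable, positive on $(-\rho/2,\rho/2)$, vanishes outside $[-\rho/2,\rho/2]$, and the kernel \[ [0,\epsilon) \times (-\rho/2, \rho/2 + \epsilon) \to \mathbb{R}, \qquad (x,y) \mapsto \Lambda(x-y) \] is $\mathrm{TN}_p$. Then the function $\mathcal{B}\{\Lambda\}(s) := \int_{-\rho/2}^{\rho/2} e^{-sx}\Lambda(x)\,dx$, $s \in \mathbb{C}$, has no zeros in the strip $|\operatorname{Im}(s)| < p\pi/\rho$.
   Context: For a totally ordered set $X$ and integer $r \geq 1$, $\operatorname{inc}(X,r)$ denotes the set of $r$-tuples $(x_1,\dots,x_r) \in X^r$ with $x_1 < \cdots < x_r$. For $X,Y \subset \mathbb{R}$, a kernel $K : X \times Y \to \mathbb{R}$ is $\mathrm{TN}_p$ if $\det (K(x_j,y_k))_{j,k=1}^r \geq 0$ for all $1 \leq r \leq p$ and all $\mathbf{x} \in \operatorname{inc}(X,r)$, $\mathbf{y} \in \operatorname{inc}(Y,r)$. *)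

(* Defs.v *)
From HB Require Import structures.
From mathcomp Require Import all_boot all_order all_algebra.
From mathcomp Require Import all_classical all_reals all_analysis.
From mathcomp Require Import complex.
Set Implicit Arguments. Unset Strict Implicit. Unset Printing Implicit Defensive.
Import Order.TTheory GRing.Theory Num.Theory.
Local Open Scope classical_set_scope.
Local Open Scope ring_scope.

Definition inc_tuple (R : realType) (X : set R) (r : nat) (x : 'I_r -> R) :=
  (forall i, X (x i)) /\ (forall i j : 'I_r, (i < j)%N -> x i < x j).

Definition TN (R : realType) (p : nat) (X Y : set R) (K : R -> R -> R) :=
  forall r : nat, (1 <= r <= p)%N ->
  forall x y : 'I_r -> R, inc_tuple X x -> inc_tuple Y y ->
    0 <= \det (\matrix_(j < r, k < r) K (x j) (y k)).

(* B{Lambda}(s) = \int_{-rho/2}^{rho/2} e^{-s x} Lambda(x) dx for s = a + i b,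
   e^{-sx} = e^{-ax} (cos(bx) - i sin(bx)); the complex integral is
   (real part integral) + i (imaginary part integral). *)
Definition bilateral_laplace (R : realType) (rho : R) (Lam : R -> R)
    (s : R[i]) : R[i] :=
  let: Complex a b := s in
  Complex (Rintegral lebesgue_measure `[- (rho / 2), rho / 2]
     (fun x => expR (- (a * x)) * cos (b * x) * Lam x))
  (Rintegral lebesgue_measure `[- (rho / 2), rho / 2]
     (fun x => - (expR (- (a * x)) * sin (b * x) * Lam x))).

(* Main.v *)
Require Import Defs.
From HB Require Import structures.
From mathcomp Require Import all_boot all_order all_algebra.
From mathcomp Require Import all_classical all_reals all_analysis.
From mathcomp Require Import complex.
From mathcomp Require Import measurable_realfun.
From mathcomp Require Import zify ring lra.
Set Implicit Arguments. Unset Strict Implicit. Unset Printing Implicit Defensive.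
Import Order.TTheory GRing.Theory Num.Theory.
Import numFieldNormedType.Exports.
Local Open Scope classical_set_scope.
Local Open Scope ring_scope.

(** If [s = a + i b] is a zero, then [u y = e^(a y) sin (|b| y + c)] is
    orthogonal to every translate [y |-> Lam (x - y)], where [x] is in a short
    interval [0, h].  As [|b| rho < p pi], for a suitable [c] the function [u]
    has at most [p - 1] sign changes on [-rho/2, rho/2 + h].  Cut this interval
    into finitely many pieces on which [u] has constant sign, and integrate [p]
    translates against [|u|] over the pieces: this gives vectors of [R^p] whose
    ordered maximal minors are nonnegative by TN_p, which span [R^p] because the
    supports of the translates start at different points, and for which some
    combination with coefficients [+1, -1] and at most [p - 1] sign changes
    vanishes.  By an argument of Gantmacher and Krein this is impossible. *)

(** * Linear algebra: sequences of vectors with nonnegative ordered minors *)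

(** The basis is extracted in the given order because only ordered minors will be known to be
    nonnegative. *)
Lemma free_subseq_span (K : fieldType) (vT : vectType K) (X : seq vT) :
  exists t, [/\ subseq t X, free t & <<t>>%VS = <<X>>%VS].
Proof.
elim: X => [|x X [t [tX ft eqt]]]; first by exists [::]; rewrite nil_free.
have [xX|xX] := boolP (x \in <<X>>%VS); [exists t | exists (x :: t)].
  split=> //; first exact: subseq_trans tX (subseq_cons X x).
  by rewrite span_cons eqt; apply/esym/addv_idPr; rewrite -memvE.
by split; rewrite /= ?eqxx // ?free_cons ?eqt ?xX // !span_cons eqt.
Qed.

Lemma subseq_cat_cons (T : eqType) (t s1 s2 : seq T) (x : T) :
  subseq t (s1 ++ x :: s2) -> exists t1 t2,
    [/\ subseq t1 s1, subseq t2 s2 & t = t1 ++ t2 \/ t = t1 ++ x :: t2].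
Proof.
move=> /subseqP[m sm ->].
have {}sm : size m = (size s1 + (size s2).+1)%N by rewrite sm size_cat.
rewrite -(cat_take_drop (size s1) m) mask_cat; last first.
  by rewrite size_take sm; case: ltnP => //; lia.
case E : (drop (size s1) m) => [|b m'].
  by move: (congr1 size E); rewrite size_drop sm addKn.
exists (mask (take (size s1) m) s1), (mask m' s2); split; rewrite ?mask_subseq //.
by case: b {E} => /=; [right | left].
Qed.

Definition rows_mx (R : realFieldType) (p : nat) (t : seq 'rV[R]_p) : 'M[R]_p :=
  \matrix_(i < p) nth 0 t i.

Lemma span_fullv_det (R : realFieldType) (p : nat) (t : seq 'rV[R]_p) :
  size t = p -> (<<t>>%VS == fullv) = (\det (rows_mx t) != 0).
Proof.
move=> st; rewrite -unitfE -[_ \is a GRing.unit]/(rows_mx t \in unitmx).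
apply/eqP/idP => [tf|tU].
  rewrite -row_full_unit -sub1mx; apply/row_subP => i; apply/submxP.
  have : row i 1%:M \in <<t>>%VS by rewrite tf memvf.
  have/eqP st' := st; move=> /(@coord_span _ _ _ (Tuple st')) ->.
  exists (\row_j coord (Tuple st') j (row i 1%:M)).
  by rewrite mulmx_sum_row; apply: eq_bigr => j _; rewrite rowK mxE.
apply/vspaceP => v; rewrite memvf -(mulmxKV tU v) mulmx_sum_row.
apply: memv_suml => j _; apply/memvZ/memv_span.
by rewrite rowK mem_nth ?st.
Qed.

(** Multilinearity in the row of index [size t1]; the bound keeps that row inside the matrix. *)
Lemma rows_mx_addr (R : realFieldType) (p : nat) (t1 t2 : seq 'rV[R]_p) a b :
  (size t1 < p)%N ->
  \det (rows_mx (t1 ++ (a + b) :: t2)) =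
  \det (rows_mx (t1 ++ a :: t2)) + \det (rows_mx (t1 ++ b :: t2)).
Proof.
move=> lt1; pose i0 := Ordinal lt1.
rewrite (@determinant_multilinear _ _ _ (rows_mx (t1 ++ a :: t2))
  (rows_mx (t1 ++ b :: t2)) i0 1 1) ?mul1r //.
- by rewrite !scale1r !rowK !nth_cat /= ltnn subnn.
all: apply/matrixP => i j; rewrite !mxE !nth_cat; case: ltnP => // le1.
all: have : lift i0 i != i0 by rewrite eq_sym neq_lift.
all: rewrite -val_eqE /=; case E : (_ - _)%N => [|k] //=.
all: by move/eqP: E; rewrite subn_eq0 => le2; rewrite eqn_leq le2 le1.
Qed.

(* Two adjacent vectors [a], [b] carrying the same sign can be merged into
   [a + b] without losing the spanning property: in a vanishing combination
   [a] lies in the span of the others, so some basis avoids [a]; if it contains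
   [b], its positive determinant can only grow when [b] becomes [a + b]. *)
Lemma alternating_sum_neq0 (R : realFieldType) (p : nat)
    (cs : seq ('rV[R]_p * nat)) :
  (0 < p)%N -> sorted leq (unzip2 cs) -> all (ltn^~ p) (unzip2 cs) ->
  (forall t, subseq t (unzip1 cs) -> size t = p -> 0 <= \det (rows_mx t)) ->
  <<unzip1 cs>>%VS = fullv ->
  \sum_(x <- cs) (-1) ^+ x.2 *: x.1 != 0.
Proof.
move=> p0; have [n] := ubnP (size cs); elim: n cs => // n IH cs /ltnSE-lecn.
move=> ms mp tn cf.
(* At most [p] spanning vectors are exactly [p] independent ones, so a combination with coefficients
   1 and -1 cannot vanish. *)
have [lecp|ltpc] := leqP (size cs) p.
  have sc : size (unzip1 cs) = p.
    apply/eqP; rewrite eqn_leq size_map lecp -(size_map fst) /=.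
    by have := dim_span (unzip1 cs); rewrite cf dimvf /dim /= mul1n.
  have := span_fullv_det sc; rewrite cf eqxx => /esym; rewrite -unitfE => dU.
  apply/negP => /eqP sum0.
  pose u : 'rV[R]_p := \row_(i < p) (-1) ^+ (nth (0, 0%N) cs i).2.
  have : u *m rows_mx (unzip1 cs) = 0.
    rewrite mulmx_sum_row -[RHS]sum0 (big_nth (0, 0%N)) big_mkord.
    rewrite -[in RHS](size_map fst) sc; apply: eq_bigr => i _.
    by rewrite rowK mxE (nth_map (0, 0%N)) // -(size_map fst) sc.
  move/(congr1 (mulmx^~ (invmx (rows_mx (unzip1 cs))))).
  rewrite mulmxK // mul0mx => /matrixP/(_ 0 (Ordinal p0))/eqP.
  by rewrite !mxE signr_eq0.
(* More than [p] exponents below [p] must repeat, and sortedness puts two equal ones side by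
   side. *)
have : ~~ sorted ltn (unzip2 cs).
  apply/negP; rewrite ltn_sorted_uniq_leq ms andbT => /uniq_leq_size.
  move=> /(_ (iota 0 p)) H; have : (size (unzip2 cs) <= size (iota 0 p))%N.
    by apply: H => m /(allP mp); rewrite mem_iota.
  by rewrite size_iota size_map leqNgt ltpc.
move=> nsort.
have [s1 [a [b [m [s2 def]]]]] : exists s1 a b m s2,
    cs = s1 ++ (a, m) :: (b, m) :: s2.
  elim: (cs) ms nsort {IH lecn mp tn cf ltpc}=> // -[a k] [|[b l] s] IHs //=.
  move=> /andP[kl srt]; have [->|neq] := eqVneq k l; first by exists [::], a, b, l, s.
  rewrite ltn_neqAle neq kl /= => /(IHs srt)[s1 [c [d [m [s2 ->]]]]].
  by exists ((a, k) :: s1), c, d, m, s2.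
set t1 := unzip1 s1; set t2 := unzip1 s2.
have sumE c d : \sum_(x <- s1 ++ (c, m) :: (d, m) :: s2) (-1) ^+ x.2 *: x.1 =
    (-1) ^+ m *: (c + d) + (\sum_(x <- s1) (-1) ^+ x.2 *: x.1 +
      \sum_(x <- s2) (-1) ^+ x.2 *: x.1) :> 'rV[R]_p.
  rewrite big_cat /= !big_cons /= scalerDr addrCA -!addrA.
  by congr (_ + _); rewrite addrCA.
apply/negP => /eqP sum0.
have := IH (s1 ++ (a + b, m) :: s2).
have -> : \sum_(x <- s1 ++ (a + b, m) :: s2) (-1) ^+ x.2 *: x.1 = 0 :> 'rV[R]_p.
  by rewrite -[RHS]sum0 def sumE big_cat /= big_cons /= addrCA.
move: ms mp tn cf ltpc lecn; rewrite def /unzip1 /unzip2 !map_cat /= -/t1 -/t2.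
rewrite !size_cat /= => ms mp tn cf ltpc lecn.
have sub c t : c \in [:: a; b] -> subseq t (t1 ++ c :: t2) ->
    subseq t (t1 ++ a :: b :: t2).
  rewrite !inE => cab /subseq_trans; apply; apply: cat_subseq => //.
  case/orP: cab => /eqP->; last exact: subseq_cons.
  by rewrite /= eqxx; exact: (subseq_cons t2 b).
rewrite eqxx => IHm; suff: ~~ true by []; apply: IHm; first by lia.
- apply: subseq_sorted ms; first exact: leq_trans.
  by apply: cat_subseq => //=; rewrite eqxx; exact: (subseq_cons (unzip2 s2) m).
- by move: mp; rewrite !all_cat /= => /and4P[-> _ -> ->].
(* A minor through the merged vector is the sum of two minors of the original list, one through [a]
   and one through [b]. *)
- move=> t /subseq_cat_cons [u1 [u2 [us1 us2]]] [->|->] su.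
    apply: tn => //; apply: cat_subseq => //.
    by apply/(subseq_trans us2)/(subseq_trans _ (subseq_cons _ a))/subseq_cons.
  have su1 : (size u1 < p)%N by move: su; rewrite size_cat /=; lia.
  rewrite rows_mx_addr //; apply: addr_ge0.
    apply: tn; last by move: su; rewrite !size_cat.
    apply: (@sub a); rewrite ?inE ?eqxx //; apply: cat_subseq => //=.
    by rewrite eqxx.
  apply: tn; last by move: su; rewrite !size_cat.
  apply: (@sub b); rewrite ?inE ?eqxx ?orbT //; apply: cat_subseq => //=.
  by rewrite eqxx.
have spanE c u : <<t1 ++ c :: u>>%VS = (<[c]> + <<t1 ++ u>>)%VS.
  by rewrite !span_cat span_cons !addvA (addvC <<t1>>%VS).
have bf : <<t1 ++ b :: t2>>%VS = fullv.
  apply/eqP; rewrite eqEsubv subvf -cf (spanE a (b :: t2)) subv_add subvv andbT -memvE.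
  have mS u : {subset u <= s1 ++ s2} ->
      \sum_(x <- u) (-1) ^+ x.2 *: x.1 \in <<t1 ++ t2>>%VS.
    move=> us; rewrite big_seq; apply: rpred_sum => x /us xs.
    by rewrite memvZ // memv_span // -map_cat map_f.
  move/(congr1 ( *:%R ((-1) ^+ m))): sum0.
  rewrite def sumE scaler0 scalerDr signrZK -addrA => /eqP; rewrite addr_eq0 => /eqP ->.
  rewrite memvN spanE; apply: memv_add; first exact: memv_line.
  by apply/memvZ/memvD; apply: mS => x; rewrite mem_cat => ->; rewrite ?orbT.
have [t [ts ft eqt]] := free_subseq_span (t1 ++ b :: t2).
have st : size t = p.
  by have /eqnP <- := ft; rewrite eqt bf dimvf /dim /= mul1n.
have dt : 0 < \det (rows_mx t).
  rewrite lt0r -span_fullv_det // eqt bf eqxx tn //.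
  by apply: (@sub b); rewrite ?inE ?eqxx ?orbT.
(* If the basis avoids [b] as well, all its vectors already occur in the merged list. *)
have [u1 [u2 [us1 us2 [ut|ut]]]] := subseq_cat_cons ts.
  apply/eqP; rewrite eqEsubv subvf -bf -eqt ut; apply: sub_span => x.
  by rewrite !mem_cat inE => /orP[/(mem_subseq us1)|/(mem_subseq us2)] ->; rewrite ?orbT.
have su1 : (size u1 < p)%N by move: st; rewrite ut size_cat /=; lia.
have sab : size (u1 ++ (a + b) :: u2) = p by move: st; rewrite ut !size_cat.
have := span_fullv_det sab; rewrite rows_mx_addr // gt_eqF; last first.
  rewrite addrC -ut ltr_pwDl //; apply: tn; last by move: sab; rewrite !size_cat.
  by apply: (@sub a); rewrite ?inE ?eqxx //; apply: cat_subseq => //=; rewrite eqxx.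
move=> /eqP fu; apply/eqP; rewrite eqEsubv subvf -fu; apply: sub_span.
by apply: mem_subseq; apply: cat_subseq => //=; rewrite eqxx.
Qed.

(** * Determinants of integrals *)

Lemma Rintegral_sum d (T : measurableType d) (R : realType)
    (mu : {measure set T -> \bar R}) (D : set T) (I : Type) (s : seq I)
    (f : I -> T -> R) :
  measurable D -> (forall i, mu.-integrable D (EFin \o f i)) ->
  Rintegral mu D (fun x => \sum_(i <- s) f i x) =
  \sum_(i <- s) Rintegral mu D (f i).
Proof.
move=> mD fi; rewrite /Rintegral; under eq_integral do rewrite -sumEFin.
rewrite integral_sum //=.
by rewrite sum_fine // => i _; exact: (integrable_fin_num mD (fi i)).
Qed.

(* The rows are integrated one at a time, expanding the determinant along the
   current row. *)
Lemma det_Rintegral_ge0 d (T : measurableType d) (R : realType)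
    (mu : {measure set T -> \bar R}) (D : set T) (p : nat)
    (f : 'I_p -> 'I_p -> T -> R) :
  measurable D -> D !=set0 -> (forall k i, mu.-integrable D (EFin \o f k i)) ->
  (forall y : 'I_p -> T, (forall k, D (y k)) ->
     0 <= \det (\matrix_(k, i) f k i (y k))) ->
  0 <= \det (\matrix_(k, i) Rintegral mu D (f k i)).
Proof.
move=> mD [y0 Dy0] fi f0.
have : forall m, (m <= p)%N -> forall y : 'I_p -> T, (forall k, D (y k)) ->
    0 <= \det (\matrix_(k < p, i < p)
      if (k < m)%N then Rintegral mu D (f k i) else f k i (y k)).
  elim=> [_ y Dy|m IH ltmp y Dy].
    by under eq_mx => k i do rewrite ltn0; exact: f0.
  pose m' := Ordinal ltmp; set A := \matrix_(k, i) _.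
  (* In [B z] the row about to be integrated is evaluated at [z]. Its cofactors ignore that row, so
     they coincide with those of [A] and are constants for the integration in [z]. *)
  pose B z : 'M[R]_p := \matrix_(k, i) if (k < m)%N then Rintegral mu D (f k i)
    else f k i (if k == m' then z else y k).
  have cofE z i : cofactor A m' i = cofactor (B z) m' i.
    rewrite /cofactor; congr (_ * \det _); apply/matrixP => k j; rewrite !mxE.
    have : lift m' k != m' by rewrite eq_sym neq_lift.
    by move/negbTE => ->; rewrite /= ltnS leq_eqVlt /bump; case: ltngtP => //=; lia.
  have Bm z i : B z m' i = f m' i z by rewrite mxE /= ltnn eqxx.
  have -> : \det A = Rintegral mu D (fun z => \sum_i f m' i z * cofactor A m' i).
    rewrite Rintegral_sum //; last first.
      move=> i; have := integrableZr mD (cofactor A m' i) (fi m' i).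
      by apply: eq_integrable.
    rewrite (expand_det_row A m'); apply: eq_bigr => i _.
    by rewrite RintegralZr // mxE /= ltnSn.
  apply: Rintegral_ge0 => z Dz.
  under eq_bigr => i _ do rewrite (cofE z) -(Bm z).
  rewrite -expand_det_row; apply: IH; first exact: ltnW.
  by move=> k; case: ifP.
move=> /(_ p (leqnn p)) detp.
have := detp (fun=> y0) (fun=> Dy0).
by under eq_mx => k i do rewrite ltn_ord.
Qed.

(** * Invariance of the Lebesgue integral under reflection *)

Section reflection.
Variables (R : realType) (x : R).
Notation mu := (@lebesgue_measure R).

Let phi (y : measurableTypeR R) : measurableTypeR R := x - y.

Let mphi : measurable_fun [set: measurableTypeR R] phi.
Proof. exact: measurable_funB. Qed.

HB.instance Definition _ := isMeasurableFun.Build _ _ _ _ phi mphi.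

(** Lebesgue measure is determined by its values on half-open intervals, and the reflection of such
    an interval is an interval of the same length. *)
Lemma lebesgue_measure_reflection (A : set R) :
  measurable A -> mu A = mu [set y | A (x - y)].
Proof.
move=> mA; apply: (@lebesgue_measure_unique R (pushforward mu phi)) => //.
move=> _ [[a b] _ <-] /=; rewrite /pushforward.
have -> : phi @^-1` `]a, b] = `[x - b, x - a[%classic.
  apply/seteqP; split => y /=; rewrite /phi !in_itv /= => /andP[? ?];
  apply/andP; split; lra.
rewrite !lebesgue_measure_itv /= !lte_fin ltrD2l ltrN2.
by case: ifP => // _; rewrite -!EFinD; congr (_%:E); ring.
Qed.

Lemma integrable_reflection (g : R -> R) :
  mu.-integrable setT (EFin \o g) ->
  mu.-integrable setT (fun y => (g (x - y))%:E).
Proof.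
move=> gi; have mg := measurable_int mu gi.
have mgx : measurable_fun setT (fun y : R => (g (x - y))%:E).
  exact: (measurableT_comp mg mphi).
apply/integrableP; split => //; have /integrableP[_] := gi.
apply: le_lt_trans; rewrite le_eqVlt; apply/orP; left; apply/eqP.
(* As [phi] is an involution, passing to the pushforward measure undoes the reflection in the
   integrand. *)
rewrite (eq_measure_integral (pushforward mu phi)) //; last first.
  by move=> A mA _; exact: lebesgue_measure_reflection.
rewrite ge0_integral_pushforward //; last exact: measurableT_comp.
apply: eq_integral => y _ /=; rewrite /phi.
by rewrite opprB addrC subrK.
Qed.

Lemma Rintegral_reflection (g : R -> R) :
  mu.-integrable setT (EFin \o g) ->
  Rintegral mu setT (fun y => g (x - y)) = Rintegral mu setT g.
Proof.
move=> gi; rewrite /Rintegral; congr fine.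
rewrite -[LHS](@integral_pushforward _ _ _ _ R phi mphi mu setT (EFin \o g)) //.
- apply: eq_measure_integral => A mA _; exact/esym/lebesgue_measure_reflection.
- exact: (measurable_int mu gi).
- exact: integrable_reflection.
Qed.

End reflection.

(** * Auxiliary facts on integrals, subdivisions and determinants *)

(** A zero integral would force [f] to vanish almost everywhere, hence [A] to be a null set. *)
Lemma Rintegral_gt0 d (T : measurableType d) (R : realType)
    (mu : {measure set T -> \bar R}) (D A : set T) (f : T -> R) :
  measurable D -> measurable A -> A `<=` D -> (0 < mu A)%E ->
  mu.-integrable D (EFin \o f) -> (forall y, D y -> 0 <= f y) ->
  (forall y, A y -> 0 < f y) -> 0 < Rintegral mu D f.
Proof.
move=> mD mA AD A0 fi f0 fA; rewrite lt0r Rintegral_ge0 // andbT.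
apply/eqP => int0; have := A0; suff -> : mu A = 0%E by rewrite ltxx.
have : (\int[mu]_(x in D) `|(f x)%:E| = 0)%E.
  under eq_integral => x /set_mem Dx do rewrite gee0_abs ?lee_fin ?f0 //.
  by rewrite -[LHS]fineK ?(integrable_fin_num mD fi) // -/(Rintegral _ _ _) int0.
move=> /(ae_eq_integral_abs mu mD (measurable_int mu fi)) [N [mN N0 sN]].
apply: (subset_measure0 _ mN _ N0) => // y Ay; apply: sN => /(_ (AD _ Ay)) [/eqP].
by rewrite gt_eqF ?fA.
Qed.

Lemma integrable_bounded_mul d (T : measurableType d) (R : realType)
    (mu : {measure set T -> \bar R}) (D : set T) (g f : T -> R) (M : R) :
  measurable D -> measurable_fun D g -> (forall x, D x -> `|g x| <= M) ->
  mu.-integrable D (EFin \o f) -> mu.-integrable D (fun x => (g x * f x)%:E).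
Proof.
move=> mD mg gM fi.
have : [bounded g x | x in D].
  exists M; split; first exact: num_real.
  by move=> y ltMy x /gM /le_trans; apply; exact: ltW.
by move=> bg; have := integrableMr mD mg bg fi; apply: eq_integrable.
Qed.

(** Serves to locate the piece containing a point, first by its position and then by its value of
    [theta]. *)
Lemma exists_step (R : realDomainType) (z : nat -> R) (n : nat) (y : R) :
  z 0%N < y <= z n -> exists2 k, (k < n)%N & z k < y <= z k.+1.
Proof.
elim: n => [|n IH] /andP[z0y yz].
  by move: (lt_le_trans z0y yz); rewrite ltxx.
have [yn|ny] := leP y (z n); last by exists n; rewrite ?ny.
by have [|k kn zk] := IH; [rewrite z0y | exists k => //; exact: ltnW].
Qed.

Lemma det_scale_rows (R : comNzRingType) (p : nat) (w : 'I_p -> R) (M : 'M[R]_p) :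
  \det (\matrix_(k, i) (w k * M k i)) = (\prod_k w k) * \det M.
Proof.
have -> : (\matrix_(k, i) (w k * M k i)) = diag_mx (\row_k w k) *m M.
  by apply/matrixP => k i; rewrite mul_diag_mx !mxE.
by rewrite det_mulmx det_diag; congr (_ * _); apply: eq_bigr => k _; rewrite mxE.
Qed.

(** * Translates of the kernel against a function with few sign changes *)

Section orthogonality_to_translates.
Local Notation mu := lebesgue_measure.

(* [theta] counts the sign changes of [u]: [u] has sign [(-1)^k] where
   [k < theta <= k + 1]. *)
Lemma translates_not_orthogonal (R : realType) (p : nat) (rho h : R)
    (L u theta : R -> R) (M : R) :
  (0 < p)%N -> 0 < rho -> 0 < h <= rho ->
  lebesgue_measure.-integrable setT (EFin \o L) ->
  (forall z, 0 <= L z) -> (forall z, - (rho / 2) < z < rho / 2 -> 0 < L z) ->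
  (forall z, ~~ (- (rho / 2) <= z <= rho / 2) -> L z = 0) ->
  TN p `]0, h[ `](- (rho / 2)), rho / 2 + h[ (fun x y => L (x - y)) ->
  measurable_fun [set: measurableTypeR R] u ->
  measurable_fun [set: measurableTypeR R] theta ->
  {homo theta : y z / y <= z} ->
  (forall y, - (rho / 2) < y < rho / 2 + h ->
     [/\ `|u y| <= M, 0 < theta y <= p%:R &
       forall k : nat, k%:R < theta y <= k.+1%:R -> 0 <= (-1) ^+ k * u y]) ->
  (forall y, - (rho / 2) < y <= h - rho / 2 -> theta y <= 1 /\ 0 < u y) ->
  exists2 x, 0 < x < h &
    Rintegral lebesgue_measure setT (fun y => L (x - y) * u y) != 0.
Proof.
move=> p0 rho0 /andP[h0 hrho] Li Lge0 Lgt0 L0 tnL mu' mtheta htheta uI uJ.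
apply: contrapT => no.
have orth x : 0 < x < h ->
    Rintegral lebesgue_measure setT (fun y => L (x - y) * u y) = 0.
  by move=> xh; apply/eqP/negPn/negP => nz; apply: no; exists x.
have pR : 0 < p%:R :> R by rewrite ltr0n.
pose d := h / p%:R.
have d0 : 0 < d by rewrite divr_gt0.
have dp : p%:R * d = h by rewrite /d mulrC divfK // gt_eqF.
(* The half shift makes the support of the translate by [x i] start at [x i - rho / 2], the midpoint
   of the initial piece [S i]. *)
pose x (i : nat) := (i%:R + 2^-1) * d.
(* The pieces [S k] with [k < p] lie where [u > 0] and only serve to make the
   first [p] vectors triangular; the truncated subtraction [k - p] gives them
   the sign exponent 0. *)
pose S (k : nat) : set R := if (k < p)%N
  then `](k%:R * d - rho / 2), (k.+1%:R * d - rho / 2)]%classic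
  else `](h - rho / 2), (rho / 2 + h)[%classic `&`
    [set y | theta y \in `](k - p)%:R, (k - p).+1%:R]].
(* The weights drop the sign of [u] so as to be nonnegative; the sign comes back as
   [(-1) ^+ (k - p)]. *)
pose W k y := `|u y| * \1_(S k) y.
pose f k i y := L (x i - y) * W k y.
have le_h k : (k <= p)%N -> k%:R * d <= h.
  by move=> kp; rewrite -dp ler_pM2r // ler_nat.
have xh i : (i < p)%N -> 0 < x i < h.
  move=> ip; have := le_h _ ip; rewrite /x -natr1 => hi.
  by have i0 := ler0n R i; apply/andP; split; nra.
have SP k y : S k y -> if (k < p)%N
    then (k%:R * d - rho / 2 < y <= k.+1%:R * d - rho / 2 : Prop)
    else (h - rho / 2 < y < rho / 2 + h) /\ ((k - p)%:R < theta y <= (k - p).+1%:R).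
  by rewrite /S; case: ifP => _ /=; rewrite !in_itv.
have SI k y : S k y -> - (rho / 2) < y < rho / 2 + h.
  move=> /SP; case: ifP => [kp|_ [/andP[? ?] _]]; last by apply/andP; split; lra.
  move=> /andP[ky yk]; have := le_h _ kp.
  have : 0 <= k%:R * d by rewrite mulr_ge0 // ltW.
  by move=> ? ?; apply/andP; split; lra.
have mS k : measurable (S k : set (measurableTypeR R)).
  rewrite /S; case: ifP => _; first exact: measurable_itv.
  apply: measurableI; first exact: measurable_itv.
  have := mtheta measurableT _ (measurable_itv `](k - p)%:R, (k - p).+1%:R]).
  by rewrite setTI.
have M0 : 0 <= M.
  have I0 : - (rho / 2) < 0 < rho / 2 + h by apply/andP; split; lra.
  by have [u0 _ _] := uI 0 I0; exact: le_trans u0.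
have WM k y : `|W k y| <= M.
  rewrite /W indicE; case: (boolP (y \in S k)) => [/set_mem/SI/uI[uM _ _]|_].
    by rewrite mulr1 normr_id.
  by rewrite mulr0 normr0.
have Wge0 k y : 0 <= W k y by rewrite /W mulr_ge0.
have W_S k y : W k y != 0 -> S k y.
  by rewrite /W indicE; case: (boolP (y \in S k)) => [/set_mem|]; rewrite ?mulr0 ?eqxx.
have S_lt k l y z : (k < l)%N -> (l < p + p)%N -> S k y -> S l z -> y < z.
  move=> kl lpp /SP + /SP; case: (ltnP l p) => lp.
    rewrite (ltn_trans kl lp) => /andP[_ yk] /andP[lz _].
    apply: le_lt_trans yk (le_lt_trans _ lz); rewrite lerD2r ler_pM2r //.
    by rewrite ler_nat.
  case: ltnP => [kp /andP[_ yk] [/andP[hz _] _]|kp [_ /andP[_ yk]] [_ /andP[lz _]]].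
    by have := le_h _ kp; lra.
  (* Both pieces are level bands of [theta], which its monotonicity puts in order. *)
  rewrite ltNge; apply/negP => /htheta; apply/negP; rewrite -ltNge.
  by apply: le_lt_trans yk (le_lt_trans _ lz); rewrite ler_nat; move: kl kp; clear; lia.
have fi k i : (lebesgue_measure).-integrable setT (EFin \o f k i).
  have mW : measurable_fun [set: measurableTypeR R] (W k).
    apply: measurable_funM; last exact: measurable_indic.
    exact: measurableT_comp.
  have := integrable_bounded_mul (mu := mu) measurableT mW (fun y _ => WM k y)
    (integrable_reflection (x i) Li).
  by apply: eq_integrable => // y _; rewrite /f /= mulrC.
pose c k : 'rV[R]_p := \row_(i < p) Rintegral lebesgue_measure setT (f k i).
pose cs := [seq (c k, k - p)%N | k <- iota 0 (p + p)].
have cs1 : unzip1 cs = [seq c k | k <- iota 0 (p + p)] by rewrite /unzip1 -map_comp.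
have cs2 : unzip2 cs = [seq k - p | k <- iota 0 (p + p)]%N by rewrite /unzip2 -map_comp.
have rowsE l : size l = p ->
    rows_mx (map c l) =
    \matrix_(k, i) Rintegral lebesgue_measure setT (f (nth 0 l k)%N i).
  by move=> sl; apply/matrixP => k i; rewrite !mxE (nth_map 0%N) ?sl // mxE.
(* Since the signed weights add up to [u] on the interval, coordinate [i] of this sum is the
   integral of [u] against the translate by [x i], which is zero by [orth]. *)
suff : \sum_(x <- cs) (-1) ^+ x.2 *: x.1 != 0.
  rewrite big_map => /negP; apply; apply/eqP/rowP => i; rewrite summxE mxE.
  rewrite -[RHS](orth (x i)) ?xh //.
  pose F k y := (-1) ^+ (k - p) * f k i y.
  transitivity (\sum_(k <- iota 0 (p + p)) Rintegral mu setT (F k)).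
    by apply: eq_bigr => k _; rewrite !mxE RintegralZl.
  rewrite -Rintegral_sum //; last first.
    move=> k; have := integrableZl measurableT ((-1) ^+ (k - p)) (fi k i).
    exact: eq_integrable.
  apply: eq_Rintegral => y _; rewrite {}/F /f.
  have [yI|yI] := boolP (- (rho / 2) < y < rho / 2 + h); last first.
    rewrite L0 ?mul0r; last first.
      apply: contra yI => /andP[? ?]; have /andP[? ?] := xh i (ltn_ord i).
      by apply/andP; split; lra.
    by rewrite big1 // => k _; rewrite mul0r mulr0.
  have [uM /andP[th0 thp] usgn] := uI _ yI; have /andP[yl yr] := yI.
  (* The piece is found by position on the initial stretch and by the value of [theta] beyond it;
     [S_lt] then excludes every other piece. *)
  have [k kpp [Sk sk]] : exists2 k, (k < p + p)%N &
      S k y /\ `|u y| = (-1) ^+ (k - p) * u y.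
    have [yh|hy] := leP y (h - rho / 2).
      have := @exists_step _ (fun k => k%:R * d - rho / 2) p y.
      rewrite mul0r add0r dp yl yh => /(_ isT)[k kp kS].
      exists k; first by rewrite ltn_addr.
      split; first by rewrite /S kp /= in_itv.
      have -> : (k - p)%N = 0%N by apply/eqP; rewrite subn_eq0 ltnW.
      by have [|_ u0] := uJ y; rewrite ?yl // mul1r gtr0_norm.
    have := @exists_step _ (fun k => k%:R) p (theta y); rewrite th0 thp.
    move=> /(_ isT)[k kp kS]; exists (k + p)%N; first by rewrite ltn_add2r.
    rewrite /S ltnNge leq_addl /= addnK !in_itv /= hy yr kS; split=> //.
    by rewrite -[RHS]ger0_norm ?usgn // normrM normr_sign mul1r.
  rewrite (bigD1_seq k) ?iota_uniq ?mem_iota //= big_seq_cond big1 ?addr0.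
    by rewrite /W indicE mem_set // mulr1 sk mulrCA [_ * (_ * u y)]signrMK.
  move=> l /andP[]; rewrite mem_iota /= add0n => lpp lk.
  have [->|/W_S Sl] := eqVneq (W l y) 0; first by rewrite !mulr0.
  have : y < y; last by rewrite ltxx.
  by case: (ltngtP l k) lk => // lk _; [exact: S_lt Sl Sk | exact: S_lt Sk Sl].
apply: alternating_sum_neq0 => //.
- rewrite cs2; apply: (homo_sorted (e := leq)); last exact: iota_sorted.
  by move=> k l /= kl; exact: leq_sub2r.
- rewrite cs2; apply/allP => _ /mapP[k + ->].
  rewrite mem_iota /=; move: p0; clear; lia.
- rewrite cs1 => _ /subseqP[m _ ->]; rewrite -map_mask size_map.
  set l := mask m _ => sl.
  have ls : sorted ltn l.
    apply: subseq_sorted (mask_subseq _ _) _; first exact: ltn_trans.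
    exact: iota_ltn_sorted.
  have lp k : (k < p)%N -> (nth 0 l k < p + p)%N.
    move=> kp; have : nth 0%N l k \in iota 0 (p + p).
      by apply: mem_subseq (mask_subseq m _) _ _; rewrite -/l mem_nth ?sl.
    by rewrite mem_iota.
  rewrite rowsE //; apply: det_Rintegral_ge0 => //; first by exists 0.
  move=> y _.
  (* The weights factor out of the rows. Either one of them is zero, or each [y k] lies in its own
     piece; the points are then increasing and TN_p applies to the remaining determinant. *)
  have -> : (\matrix_(k < p, i < p) f (nth 0 l k)%N i (y k)) =
    \matrix_(k, i) (W (nth 0 l k)%N (y k) *
      (\matrix_(k, i) L (x i - y k)) k i) :> 'M[R]_p.
    by apply/matrixP => k i; rewrite !mxE mulrC.
  rewrite det_scale_rows.
  have [/forallP Wn0|] := boolP [forall k : 'I_p, W (nth 0 l k)%N (y k) != 0]; last first.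
    rewrite negb_forall => /existsP[k]; rewrite negbK => /eqP Wk.
    by rewrite (bigD1 k) //= Wk !mul0r.
  apply: mulr_ge0; first by apply: prodr_ge0.
  rewrite -det_tr.
  have := tnL p; rewrite leqnn p0 => /(_ isT (fun i => x i) y).
  have Sy (k : 'I_p) : S (nth 0 l k)%N (y k) by exact: W_S.
  have -> : (\matrix_(k < p, i < p) L (x i - y k))^T =
    \matrix_(j, k) L (x j - y k) by apply/matrixP => j k; rewrite !mxE.
  apply; split=> [i|i j ij].
  - by rewrite /= in_itv /= xh.
  - by rewrite /x ltr_pM2r // ltrD2r ltr_nat.
  - by rewrite /= in_itv /=; exact: SI (Sy i).
  - apply: S_lt (Sy i) (Sy j); last exact: lp.
    by rewrite (sorted_ltn_nth ltn_trans) ?inE ?sl.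
apply/eqP; rewrite eqEsubv subvf cs1.
(* The initial pieces suffice. For [k < i] the piece [S k] ends before the support of the translate
   by [x i] starts, so the matrix is triangular; its diagonal entries are positive. *)
have /eqP <- : <<[seq c k | k <- iota 0 p]>>%VS == fullv.
  rewrite span_fullv_det ?rowsE ?size_map ?size_iota //.
  have -> : (\matrix_(k < p, i < p)
      Rintegral lebesgue_measure setT (f (nth 0 (iota 0 p) k)%N i)) =
    \matrix_(k < p, i < p) Rintegral lebesgue_measure setT (f k i) :> 'M[R]_p.
    by apply/matrixP => k i; rewrite !mxE nth_iota.
  rewrite det_trig; last first.
    apply/is_trig_mxP => k i ki; rewrite mxE.
    rewrite -[RHS](mul0r (fine (mu [set: measurableTypeR R]))) -Rintegral_cst //.
    apply: eq_Rintegral => y _ /=.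
    rewrite /f; have [->|/W_S/SP] := eqVneq (W k y) 0; first by rewrite mulr0.
    rewrite ltn_ord => /andP[_ yk]; rewrite L0 ?mul0r //; apply/negP => /andP[_].
    have : k.+1%:R * d <= i%:R * d by rewrite ler_pM2r // ler_nat.
    by rewrite /x; lra.
  apply/prodf_neq0 => k _; rewrite mxE gt_eqF //.
  have xk : x k = k%:R * d + d / 2 by rewrite /x; lra.
  have sk : k.+1%:R * d = k%:R * d + d by rewrite -natr1; lra.
  have k0 : 0 <= k%:R * d by rewrite mulr_ge0 // ltW.
  have := le_h _ (ltn_ord k); rewrite sk => kh.
  (* The right half of [S k] lies in the open support of the translate by [x k]; [h <= rho] keeps it
     from reaching the far end. *)
  pose A := `](x k - rho / 2), (k.+1%:R * d - rho / 2)]%classic : set (measurableTypeR R).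
  apply: (@Rintegral_gt0 _ _ _ _ setT A) => //.
  - exact: measurable_itv.
  - have muA : mu A = (if (x k - rho / 2 < k.+1%:R * d - rho / 2)%R
        then (k.+1%:R * d - rho / 2)%R%:E - (x k - rho / 2)%R%:E else 0)%E.
      exact: lebesgue_measure_itv.
    apply: (@lt_le_trans _ _ (mu A)); last exact: lexx.
    by rewrite muA xk sk ifT -?EFinB ?lte_fin; lra.
  - by move=> y _; rewrite mulr_ge0.
  - move=> y; rewrite /A /= in_itv /= xk sk => /andP[ky yk].
    rewrite /f /W mulr_gt0 ?Lgt0 ?xk //; first by apply/andP; split; lra.
    rewrite indicE mem_set ?mulr1; last first.
      by rewrite /S ltn_ord /= in_itv /= sk; apply/andP; split; lra.
    by rewrite normr_gt0 gt_eqF //; apply: (proj2 (uJ y _)); apply/andP; split; lra.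
apply: sub_span => v /mapP[k kp ->]; apply: map_f.
by move: kp; rewrite !mem_iota; clear; lia.
Qed.

End orthogonality_to_translates.

(** * The test function built from a zero of the transform *)

Lemma alternating_sin_ge0 (R : realType) (k : nat) (x : R) :
  k%:R * pi <= x <= k.+1%:R * pi -> 0 <= (-1) ^+ k * sin x.
Proof.
rewrite -natr1 => /andP[kx xk].
have := alternatingn (@sinDpi R) k (x - k%:R * pi).
rewrite -[pi *+ k]mulr_natl subrK => ->; rewrite signrMK sin_ge0_pi //.
by apply/andP; split; lra.
Qed.

Theorem theoremD (R : realType) (rho eps : R) (rhot : \bar R) (p : nat)
  (Lam : R -> R) :
  0 < rho -> (rho%:E <= rhot)%E -> 0 < eps -> (eps%:E <= rhot - (rho / 2)%:E)%E ->
  (2 <= p)%N ->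
  lebesgue_measure.-integrable [set x : R | (- rhot < x%:E < rhot)%E]
    (fun x => (Lam x)%:E) ->
  (forall x, - (rho / 2) < x < rho / 2 -> 0 < Lam x) ->
  (forall x, (- rhot < x%:E < rhot)%E -> ~ (- (rho / 2) <= x <= rho / 2) ->
     Lam x = 0) ->
  TN p `[0, eps[ `](- (rho / 2)), rho / 2 + eps[ (fun x y => Lam (x - y)) ->
  forall s : R[i], `|complex.Im s| < p%:R * pi / rho ->
    bilateral_laplace rho Lam s != 0.
Proof.
move=> rho0 hrhot eps0 heps p2 Lami Lamgt0 Lamz tnLam [a b] /= hb.
apply/negP => /eqP [Re0 Im0].
have p0 : (0 < p)%N by exact: ltnW.
have pi0 : 0 < pi :> R := pi_gt0 R.
(* This window contains every difference [x - y] at which the kernel is evaluated, and the bound on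
   [eps] places it where [Lam] is controlled. *)
have in_rhot (z : R) : - (rho / 2 + eps) < z < rho / 2 + eps -> (- rhot < z%:E < rhot)%E.
  case: rhot hrhot heps {Lami Lamz} => [r||] //=; last first.
    by move=> _ _ _; rewrite ltNyr ltry.
  rewrite !lee_fin !lte_fin => _ ? /andP[? ?].
  by apply/andP; split; lra.
pose D := `[- (rho / 2), rho / 2]%classic : set (measurableTypeR R).
have mD : measurable D by exact: measurable_itv.
have LamDi : lebesgue_measure.-integrable D (EFin \o Lam).
  apply: integrableS Lami => //.
    have mE : measurable_fun [set: measurableTypeR R] EFin := @EFin_measurable R setT.
    have := mE measurableT _ (emeasurable_itv `]- rhot, rhot[%E).
    by rewrite setTI (_ : _ @^-1` _ = [set x : R | (- rhot < x%:E < rhot)%E]).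
  move=> z; rewrite /D /= in_itv /= => /andP[? ?].
  by apply: in_rhot; apply/andP; split; lra.
(* Nothing is assumed on [Lam] beyond [rhot], so it is replaced by its extension by zero. *)
pose L := Lam \_ D.
have LE z : L z = if - (rho / 2) <= z <= rho / 2 then Lam z else 0.
  by rewrite /L patchE mem_setE in_itv.
have LLam (z : R) : - (rho / 2 + eps) < z < rho / 2 + eps -> L z = Lam z.
  by move=> /in_rhot /Lamz; rewrite LE; case: ifP => // _ ->.
have Li : lebesgue_measure.-integrable setT (EFin \o L).
  have := LamDi; rewrite integrable_mkcond //; apply: eq_integrable => // z _.
  by rewrite /= /L !patchE; case: ifP.
pose beta := `|b|.
have beta0 : 0 <= beta by exact: normr_ge0.
have betarho : beta * rho < p%:R * pi by rewrite -ltr_pdivlMr.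
(* One [eta] is the initial phase, making the sine positive at the left end; a second absorbs the
   growth [beta * h]; the third leaves strict room below [pi] and [p%:R * pi]. *)
have [eta [eta0 eta1 eta2]] : exists eta,
    [/\ 0 < eta, 3 * eta <= pi & 3 * eta <= p%:R * pi - beta * rho].
  exists (Num.min (p%:R * pi - beta * rho) pi / 3); set m := Num.min _ _.
  have m0 : 0 < m by rewrite lt_min subr_gt0 betarho.
  have m1 : m <= pi by rewrite ge_min lexx orbT.
  have m2 : m <= p%:R * pi - beta * rho by rewrite ge_min lexx.
  by split; lra.
(* The denominator [beta + 1] also covers the case [b = 0]. *)
pose h := Num.min eps (Num.min rho (eta / (beta + 1))).
have b1 : 0 < beta + 1 by rewrite ltr_wpDl.
have h0 : 0 < h by rewrite /h !lt_min eps0 rho0 divr_gt0.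
have [heps' hrho hb1] : [/\ h <= eps, h <= rho & h * (beta + 1) <= eta].
  by rewrite -ler_pdivlMr // /h !ge_min !lexx !orbT.
have betah : beta * h <= eta by nra.
pose phi y := beta * (y + rho / 2) + eta.
pose u y := expR (a * y) * sin (phi y).
pose M := expR (`|a| * (rho / 2 + h)).
have phi_mono : {homo phi : y z / y <= z}.
  by move=> y z yz; rewrite /phi lerD2r ler_wpM2l // lerD2r.
have phiI y : - (rho / 2) < y < rho / 2 + h -> 0 < phi y <= p%:R * pi.
  by rewrite /phi => /andP[? ?]; apply/andP; split; nra.
have mphi : measurable_fun [set: measurableTypeR R] phi.
  apply: (@continuous_measurable_fun R) => y; apply: cvgD; last exact: cvg_cst.
  by apply: cvgM; [exact: cvg_cst | apply: cvgD; [exact: cvg_id | exact: cvg_cst]].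
have mtheta : measurable_fun [set: measurableTypeR R] (fun y => phi y / pi).
  by apply: measurable_funM => //; exact: measurable_cst.
have mexp (c : R) : measurable_fun [set: measurableTypeR R] (fun y => expR (c * y)).
  apply: (measurableT_comp (@measurable_expR R)).
  by apply: measurable_funM; [exact: measurable_cst | exact: measurable_id].
have mu' : measurable_fun [set: measurableTypeR R] u.
  apply: measurable_funM; first exact: mexp.
  by apply: measurableT_comp mphi;
    apply: continuous_measurable_fun; exact: continuous_sin.
(* At the endpoints of the support nonnegativity comes from TN_1, with the points [eps / 2] and
   [eps / 2 - z] whose difference is [z]. *)
have Lge0 (z : R) : 0 <= L z.
  rewrite LE; case: ifP => // /andP[? ?].
  have := tnLam 1%N; rewrite /= p0 => /(_ isT (fun=> eps / 2) (fun=> eps / 2 - z)).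
  rewrite det_mx11 mxE subKr; apply.
    by split=> [i|i j]; rewrite ?ord1 //= in_itv /=; apply/andP; split; lra.
  by split=> [i|i j]; rewrite ?ord1 //= in_itv /=; apply/andP; split; lra.
have Lgt0 (z : R) : - (rho / 2) < z < rho / 2 -> 0 < L z.
  move=> zI; rewrite LLam ?Lamgt0 //.
  by case/andP: zI => ? ?; apply/andP; split; lra.
have L0 (z : R) : ~~ (- (rho / 2) <= z <= rho / 2) -> L z = 0.
  by rewrite LE => /negbTE ->.
have tnL : TN p `]0, h[ `](- (rho / 2)), rho / 2 + h[ (fun x y => L (x - y)).
  move=> r rp x y [xX xmono] [yY ymono].
  have {}xX i : 0 < x i < h by have := xX i; rewrite /= in_itv.
  have {}yY i : - (rho / 2) < y i < rho / 2 + h by have := yY i; rewrite /= in_itv.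
  have -> : \matrix_(j < r, k < r) L (x j - y k) = \matrix_(j, k) Lam (x j - y k).
    apply/matrixP => j k; rewrite !mxE LLam //.
    have /andP[? ?] := xX j; have /andP[? ?] := yY k.
    by apply/andP; split; lra.
  apply: tnLam => //; split=> // i; rewrite /= in_itv /=.
    by have /andP[? ?] := xX i; apply/andP; split; lra.
  by have /andP[? ?] := yY i; apply/andP; split; lra.
have uI (y : R) : - (rho / 2) < y < rho / 2 + h ->
    [/\ `|u y| <= M, 0 < phi y / pi <= p%:R &
      forall k : nat, k%:R < phi y / pi <= k.+1%:R -> 0 <= (-1) ^+ k * u y].
  move=> yI; have /andP[phi0 phip] := phiI _ yI; have /andP[y1 y2] := yI.
  split.
  - rewrite /u /M normrM (ger0_norm (expR_ge0 _)) -[leRHS]mulr1.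
    rewrite ler_pM ?expR_ge0 ?sin_max // ler_expR.
    apply: le_trans (ler_norm _) _; rewrite normrM ler_wpM2l //.
    by rewrite ler_norml; apply/andP; split; lra.
  - by rewrite divr_gt0 //= ler_pdivrMr.
  - move=> k /andP[k1 k2]; rewrite /u mulrCA mulr_ge0 ?expR_ge0 //.
    apply: alternating_sin_ge0; rewrite -(ler_pdivlMr _ _ pi0) ltW //=.
    by rewrite -(ler_pdivrMr _ _ pi0).
have uJ (y : R) : - (rho / 2) < y <= h - rho / 2 -> phi y / pi <= 1 /\ 0 < u y.
  move=> /andP[y1 y2].
  have phi0 : 0 < phi y by rewrite /phi; nra.
  have phi1 : phi y < pi by rewrite /phi; nra.
  rewrite ler_pdivrMr // mul1r ltW //; split=> //.
  by rewrite /u mulr_gt0 ?expR_gt0 // sin_gt0_pi // phi0.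
have htheta : {homo (fun y => phi y / pi) : y z / y <= z}.
  by move=> y z /phi_mono; rewrite ler_pM2r ?invr_gt0.
have h0h : 0 < h <= rho by rewrite h0.
have [x xh] := translates_not_orthogonal p0 rho0 h0h Li Lge0 Lgt0 L0 tnL mu' mtheta
  htheta uI uJ.
(* It remains to show that this integral vanishes. The substitution [z = x - y] will reduce it to
   the real and imaginary parts [C] and [S] of the transform. *)
apply/negP/negPn/eqP.
pose C z := expR (- (a * z)) * cos (b * z) * Lam z.
pose S z := - (expR (- (a * z)) * sin (b * z) * Lam z).
have expM (z : R) : D z -> expR (- (a * z)) <= expR (`|a| * (rho / 2)).
  rewrite /D /= in_itv /= => /andP[? ?]; rewrite ler_expR.
  apply: le_trans (ler_norm _) _; rewrite normrN normrM ler_wpM2l //.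
  by rewrite ler_norml; apply/andP; split; lra.
have mexpD : measurable_fun D (fun z => expR (- (a * z))).
  have := measurable_funTS (D := D) (mexp (- a)).
  by apply: eq_measurable_fun => z _; rewrite mulNr.
have int_trig (f : R -> R) : measurable_fun [set: measurableTypeR R] f ->
    (forall z, `|f z| <= 1) ->
    lebesgue_measure.-integrable D (EFin \o (fun z => expR (- (a * z)) * f z * Lam z)).
  move=> mf f1; apply: (@integrable_bounded_mul _ _ _ _ _ _ _ (expR (`|a| * (rho / 2)))) => //.
    by apply: measurable_funM => //; exact: measurable_funTS.
  move=> z Dz; rewrite normrM (ger0_norm (expR_ge0 _)) -[leRHS]mulr1.
  by rewrite ler_pM ?expR_ge0 ?expM.
have mbz : measurable_fun [set: measurableTypeR R] (fun z => b * z).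
  by apply: measurable_funM; [exact: measurable_cst | exact: measurable_id].
have Ci : lebesgue_measure.-integrable D (EFin \o C).
  apply: int_trig => [|z]; last exact: cos_max.
  by apply: measurableT_comp mbz;
    apply: continuous_measurable_fun; exact: continuous_cos.
have Si : lebesgue_measure.-integrable D (EFin \o S).
  have : lebesgue_measure.-integrable D
      (EFin \o (fun z => expR (- (a * z)) * (- sin (b * z)) * Lam z)).
    apply: int_trig => [|z]; last by rewrite normrN; exact: sin_max.
    apply: measurable_funN.
    by apply: measurableT_comp mbz;
    apply: continuous_measurable_fun; exact: continuous_sin.
  by apply: eq_integrable => // z _; rewrite /S /= mulrN mulNr.
(* Coefficients from expanding the sine of [phi x - beta * z]. The factor [Num.sg b] restores the
   sign lost in [beta], and [c2] enters with a plus because [S] carries the minus. *)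
pose c1 := expR (a * x) * sin (phi x); pose c2 := expR (a * x) * cos (phi x) * Num.sg b.
have LuE z : L z * u (x - z) = ((fun z => c1 * C z + c2 * S z) \_ D) z.
  rewrite /L !patchE; case: ifP => _; last by rewrite mul0r.
  have bz : beta * z = Num.sg b * (b * z) by rewrite /beta normrEsg mulrA.
  have cz : cos (beta * z) = cos (b * z).
    by rewrite /beta; case: (ger0P b) => _ //; rewrite mulNr cosN.
  have pz : phi (x - z) = phi x - beta * z by rewrite /phi; ring.
  rewrite /u pz sinB cz bz sin_sg (mulrBr a) expRD /c1 /c2 /C /S; ring.
pose g z := L z * u (x - z).
have gE : g = (fun z => c1 * C z + c2 * S z) \_ D by apply/funext.
have C1i : lebesgue_measure.-integrable D (EFin \o (fun z => c1 * C z)).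
  by have := integrableZl mD c1 Ci; apply: eq_integrable.
have S1i : lebesgue_measure.-integrable D (EFin \o (fun z => c2 * S z)).
  by have := integrableZl mD c2 Si; apply: eq_integrable.
have gi : lebesgue_measure.-integrable setT (EFin \o g).
  have := integrableD mD C1i S1i; rewrite integrable_mkcond //.
  by apply: eq_integrable => // z _; rewrite gE /= !patchE; case: ifP.
have -> : (fun y => L (x - y) * u y) = (fun y => g (x - y)).
  by apply/funext => y; rewrite /g subKr.
rewrite Rintegral_reflection // gE -Rintegral_mkcond RintegralD // !RintegralZl //.
have -> : Rintegral lebesgue_measure D C = 0 by exact: Re0.
have -> : Rintegral lebesgue_measure D S = 0 by exact: Im0.
by rewrite !mulr0 addr0.
Qed.
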